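(* Let $\mathbb{F}_{81}$ be the field with $81$ elements and let $G_{81,20}=\{x\in\mathbb{F}_{81}: x^{20}=1\}$ be the unique subgroup of order $20$ of $\mathbb{F}_{81}^\times$. For $a,b,c\in G_{81,20}$, we have $a+b+c=0$ if and only if $a=b=c$. *)

(* Defs.v *)
From HB Require Import structures.
From mathcomp Require Import all_boot all_order all_algebra.
From mathcomp Require Import all_fingroup all_solvable all_field.
Set Implicit Arguments.
Unset Strict Implicit.
Unset Printing Implicit Defensive.
Import GRing.Theory.
Local Open Scope ring_scope.

(* G_{q,n} for the finite field F with q elements; 0 is excluded when n > 0. *)
Definition Gqn (F : finFieldType) (n : nat) : {set F} :=
  [set x : F | x ^+ n == 1].

(* If n > 0 divides q - 1 then G_{q,n} is
   the unique subgroup of order n of the multiplicative group of F. *)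
Lemma Gqn_unique_subgroup (F : finFieldType) (n : nat) :
  (0 < n)%N -> (n %| #|F|.-1)%N ->
  exists H : {group {unit F}},
    [/\ #|H| = n, [set val u | u in H] = Gqn F n
      & forall K : {group {unit F}}, #|K| = n -> K = H].
Proof.
move=> n0 dn.
have /cyclicP[g Eg] := field_unit_group_cyclic [set: {unit F}]%G.
have cg : #|F|.-1 = #[g]%g by rewrite orderE -Eg card_finField_unit.
have sub (H : {group {unit F}}) : #|H| = n -> [set val u | u in H] = Gqn F n.
  move=> cH; apply/eqP; rewrite eqEcard; apply/andP; split.
    apply/subsetP=> _ /imsetP[u uH ->].
    by rewrite inE /= -FinRing.val_unitX -cH expg_cardG.
  rewrite card_imset; last exact: val_inj.
  rewrite cH cardE; apply: max_unity_roots => //; last exact: enum_uniq.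
  by apply/allP=> x; rewrite mem_enum inE unity_rootE.
have cH : #|<[(g ^+ (#[g] %/ n))%g]>%g| = n.
  have ng : (n %| #[g]%g)%N by rewrite -cg.
  rewrite -orderE orderXdiv ?dvdn_div // divnA // mulKn //.
exists <[(g ^+ (#[g] %/ n))%g]>%G; split=> // [|K cK]; first exact: sub.
apply/group_inj/(imset_inj val_inj).
by rewrite [LHS]sub // [RHS]sub.
Qed.

(* Main.v *)
(* Dividing by a, it suffices that x^20 = (1 + x)^20 = 1 forces x = 1 in
   characteristic 3. There (1 + x)^9 = 1 + x^9, so (1 + x)(1 + x^9) = d and
   x^10 = e with d, e = ±1. Eliminating x^9 gives x^2 + (1 + e - d)x + e = 0.
   For e = d = 1 this is (x - 1)^2 = 0, and each of the other three quadratics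
   contradicts x^10 = e. *)
Require Import Defs.
From mathcomp Require Import all_boot all_order all_algebra.
From mathcomp Require Import all_field ring.
Import GRing.Theory.
Local Open Scope ring_scope.

Lemma pchar3_unity_root20_add1 (F : fieldType) (x : F) :
  3%N \in [pchar F] -> x ^+ 20 = 1 -> (1 + x) ^+ 20 = 1 -> x = 1.
Proof.
move=> ch3 x20 y20.
have h3 : 3 = 0 :> F by exact: pcharf0 ch3.
have sqr1 (z : F) : z ^+ 2 = 1 -> z = 1 \/ z = -1.
  by move/eqP; rewrite sqrf_eq1 => /orP[] /eqP; [left | right].
have two_neq0 : 2 <> 0 :> F.
  move=> h2; have /eqP := oner_neq0 F; apply.
  by transitivity (3 - 2 : F); [ring | rewrite h3 h2 subr0].
(* [5] is the value left over when [x = -2] or [x = 2] is put into the quadratics for [e = -1]. *)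
have five_neq0 : 5 <> 0 :> F.
  by move=> h5; apply: two_neq0; transitivity (5 - 3 : F);
    [ring | rewrite h3 h5 subr0].
have frob : (1 + x) ^+ 9 = 1 + x ^+ 9.
  by rewrite exprDn_pchar ?expr1n // -[9%N]/(3 ^ 2)%N pnatX pnatE ?ch3.
have [d [e [hd he d1 e1]]] : exists d e : F,
    [/\ (1 + x) * (1 + x ^+ 9) = d, x ^+ 10 = e,
        d = 1 \/ d = -1 & e = 1 \/ e = -1].
  exists ((1 + x) * (1 + x ^+ 9)), (x ^+ 10); split=> //; apply: sqr1.
    by rewrite -frob -exprS -exprM.
  by rewrite -exprM.
(* Multiplying [hd] by [x] and replacing [x ^+ 10] by [e] gives [(1 + x) * (x + e) = d * x]. *)
have quad : x ^+ 2 = (d - 1 - e) * x - e by rewrite -he -hd; ring.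
(* The cases are [(d, e) = (1, 1)], [(1, -1)], [(-1, 1)], [(-1, -1)], in this order. *)
case: d1 e1 => -> [] -> in quad he *.
- have : (x - 1) ^+ 2 = 0.
    transitivity (x ^+ 2 + x + 1 - 3 * x); first by ring.
    by rewrite quad h3; ring.
  by move/eqP; rewrite expf_eq0 subr_eq0 /= => /eqP.
- have x4 : x ^+ 4 = -1.
    transitivity ((x ^+ 2) ^+ 2); first by ring.
    rewrite quad; transitivity (x ^+ 2 + 2 * x + 1); first by ring.
    by rewrite quad; transitivity (3 * x + 3 - 1); [ring | rewrite h3; ring].
  (* From [x ^+ 4 = -1] follows [x ^+ 8 = 1], so [x ^+ 2 = x ^+ 10 = -1], and the quadratic becomes
     linear in [x]. *)
  have xE : x = -2.
    transitivity (x ^+ 2 - 1); first by rewrite quad; ring.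
    transitivity ((x ^+ 4) ^+ 2 * x ^+ 2 - 1); first by rewrite x4; ring.
    by transitivity (x ^+ 10 - 1); [ring | rewrite he; ring].
  case: five_neq0; transitivity (x ^+ 2 - x - 1); first by rewrite xE; ring.
  by rewrite quad; ring.
- have x2 : x ^+ 2 = -1.
    by rewrite quad; transitivity (- (3 * x) - 1); [ring | rewrite h3; ring].
  (* The fifth power of [x ^+ 2 = -1] is [-1], whereas [e = 1]. *)
  case: two_neq0; transitivity (1 - (x ^+ 2) ^+ 5); first by rewrite x2; ring.
  by rewrite -exprM he subrr.
- have x4 : x ^+ 4 = -1.
    transitivity ((x ^+ 2) ^+ 2); first by ring.
    rewrite quad; transitivity (x ^+ 2 - 2 * x + 1); first by ring.
    by rewrite quad; transitivity (3 - 3 * x - 1); [ring | rewrite h3; ring].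
  (* Again [x ^+ 8 = 1] forces [x ^+ 2 = x ^+ 10 = -1]. *)
  have xE : x = 2.
    transitivity (1 - x ^+ 2); first by rewrite quad; ring.
    transitivity (1 - (x ^+ 4) ^+ 2 * x ^+ 2); first by rewrite x4; ring.
    by transitivity (1 - x ^+ 10); [ring | rewrite he; ring].
  case: five_neq0; transitivity (x ^+ 2 + x - 1); first by rewrite xE; ring.
  by rewrite quad; ring.
Qed.

Theorem theorem1 (F : finFieldType) (card_F : #|F| = 81%N) (a b c : F)
    (Ga : a \in Gqn F 20) (Gb : b \in Gqn F 20) (Gc : c \in Gqn F 20) :
  a + b + c = 0 <-> (a = b /\ b = c).
Proof.
have ch3 : 3%N \in [pchar F] by exact: (@card_finPcharP F 3 4).
have h3 : 3 = 0 :> F by exact: pcharf0 ch3.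
split=> [abc0 | [-> ->]]; last first.
  by transitivity (3 * c); [ring | rewrite h3 mul0r].
move: Ga Gb Gc; rewrite !inE => /eqP a20 /eqP b20 /eqP c20.
have a0 : a != 0.
  by apply/eqP => a0; move/eqP: a20; rewrite a0 expr0n eq_sym oner_eq0.
have ba : b / a = 1.
  apply: pchar3_unity_root20_add1 => //.
    by rewrite expr_div_n a20 b20 divr1.
  (* The sign disappears in the 20th power because the exponent is even. *)
  have -> : 1 + b / a = - c / a.
    rewrite -{1}(divff a0) -mulrDl; congr (_ / a).
    by apply/eqP; rewrite -addr_eq0 abc0.
  by rewrite expr_div_n exprNn c20 a20 divr1 mulr1 -signr_odd.
have ab : a = b by rewrite -[b](divfK a0) ba mul1r.
split=> //; rewrite ab in abc0.
(* With [a = b] the sum is [2 * b + c], and [2 = -1] in characteristic 3. *)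
transitivity (3 * b - (b + b + c) + c); first by ring.
by rewrite h3 abc0 mul0r subr0 add0r.
Qed.
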